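(* Let $n\ge 2$, let $A\in\widetilde{\mathcal H}_n$ be synchronizing at level $k$, and let $r\ge k$. If the graph of bad pairs $G_r(A)$ has a circuit (a directed closed path of length at least one), then there is a rational word $x\in X_n^{\mathbb Z}$ on an infinite orbit under the action of $A$, i.e. the set $\{f_A^t(x): t\in\mathbb N\}$ is infinite, where $f_A$ is the map of $X_n^{\mathbb Z}$ induced by $A$.
   Context: $X_n=\{0,\dots,n-1\}$. A synchronous transducer $A=\langle X_n,Q,\pi,\lambda\rangle$ has finite state set $Q$, transition function $\pi:X_n\times Q\to Q$ and output function $\lambda:X_n\times Q\to X_n$, extended to words by $\pi(\Gamma x,q)=\pi(x,\pi(\Gamma,q))$, $\lambda(\Gamma x,q)=\lambda(\Gamma,q)\lambda(x,\pi(\Gamma,q))$. Each state $q$ induces a continuous map $A_q:X_n^{\mathbb N}\to X_n^{\mathbb N}$; $q$ is a homeomorphism state if $A_q$ is a homeomorphism. Two states are $\omega$-equivalent if they induce the same map; $A$ is minimal if distinct states are never $\omega$-equivalent. Product: $A*B$ has states $Q_A\times Q_B$, $\pi_{A*B}(x,(p,q))=(\pi_A(x,p),\pi_B(\lambda_A(x,p),q))$, $\lambda_{A*B}(x,(p,q))=\lambda_B(\lambda_A(x,p),q)$. $A^i=A*\cdots*A$ ($i$ factors) has states $Q^i$ and transition/output functions $\pi_i,\lambda_i$. $A$ is synchronizing at level $k$ if there is $\mathfrak s:X_n^k\to Q$ with $\pi(\Gamma,q)=\mathfrak s(\Gamma)$ for all $\Gamma\in X_n^k$, $q\in Q$; $\mathfrak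 s(\Gamma)$ is the state forced by $\Gamma$; more generally, a word of length at least $k$ forces the unique state to which it is read from every state. The core of $A$ is the image of $\mathfrak s$, and $A$ is core if it equals its core. A core transducer synchronizing at level $k$ induces $f_A:X_n^{\mathbb Z}\to X_n^{\mathbb Z}$, $f_A(x)_i=\lambda(x_i,\mathfrak s(x_{i-k}\cdots x_{i-1}))$. $\widetilde{\mathcal P}_n$ is the monoid of finite, synchronous, synchronizing, core transducers, each represented by its minimal transducer, the product of $A,B$ being the minimal transducer representing the core of $A*B$. $\widetilde{\mathcal H}_n$ is the set of elements of $\widetilde{\mathcal P}_n$ having a homeomorphism state. Splits. Let $A\in\widetilde{\mathcal P}_n$ and let $r$ be at least the minimal synchronizing level of $A$. For a state $t$ let $W_t$ be the set of words, of length at least the minimal synchronizing level, forcing $t$. A split of length $l\ge 1$ (of the level-$r$ dual $A^\vee_r$) is a triple $((q_1,\dots,q_l),(p_1,\dots,p_l),\Gamma)$ with $q_i,p_i\in Q$, $\Gamma\in X_n^r$, such that there are $s_1,\dots,s_l\in Q$ and distinct $t_1,t_2\in Q$ satisfying: with $\Gamma_0=\Lambda_0=\Gamma$, $\Gamma_i=\lambda(\Gamma_{i-1},p_i)$, $\Lambda_i=\lambda(\Lambda_{i-1},q_i)$ for $1\le i\le l$, one has $\Gamma_i,\Lambda_i\in W_{s_{i+1}}$ for $0\le i\le l-1$, $\Gamma_l\in W_{t_1}$, $\Lambda_l\in W_{t_2}$. Its top is $\{p_1,q_1\}$ and its bottom is $\{t_1,t_2\}$. The bottom of the split depends only on the top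 if for all $U_1,U_2\in Q^{l-1}$ the triple $((q_1,U_1),(p_1,U_2),\Gamma)$ is also a split with bottom $\{t_1,t_2\}$, and moreover for all $u,u'\in Q$, $\pi_{l+1}(\Gamma,(p_1,\dots,p_l,u))=\pi_{l+1}(\Gamma,(p_1,U_2,u'))$ and $\pi_{l+1}(\Gamma,(q_1,\dots,q_l,u))=\pi_{l+1}(\Gamma,(q_1,U_1,u'))$. Graph of bad pairs. $G_r(A)$ is the directed graph whose vertices (the bad pairs) are the tops of those splits of $A^\vee_r$ (of any length) whose bottom depends only on the top; there is an edge from the bad pair $\{x_1,x_2\}$ to the bad pair $\{y_1,y_2\}$ if there is a split of $A^\vee_r$ with top $\{x_1,x_2\}$ and bottom $\{y_1,y_2\}$ whose bottom depends only on the top. A rational word in $X_n^{\mathbb Z}$ is a bi-infinite word that is eventually periodic in both directions. *)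

(* Defs.v *)
From mathcomp Require Import all_boot all_algebra.
From mathcomp Require Import boolp classical_sets functions cardinality topology.

Set Implicit Arguments.
Unset Strict Implicit.
Unset Printing Implicit Defensive.

Import GRing.Theory.

Record transducer (n : nat) : Type := Transducer {
  state : finType;
  trans : 'I_n -> state -> state;
  outp : 'I_n -> state -> 'I_n }.

Definition trans_word n (A : transducer n) (w : seq 'I_n) (q : state A) :
  state A := foldl (fun p x => trans x p) q w.

Fixpoint out_word n (A : transducer n) (w : seq 'I_n) (q : state A) :
  seq 'I_n :=
  if w is x :: w' then outp x q :: out_word w' (trans x q) else [::].

Lemma trans_word_rcons n (A : transducer n) w x (q : state A) :
  trans_word (rcons w x) q = trans x (trans_word w q).
Proof. by rewrite /trans_word -cats1 foldl_cat. Qed.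

Lemma out_word_rcons n (A : transducer n) w x (q : state A) :
  out_word (rcons w x) q = rcons (out_word w q) (outp x (trans_word w q)).
Proof. by elim: w q => [|y w IHw] q //=; rewrite IHw. Qed.

Lemma size_out_word n (A : transducer n) w (q : state A) :
  size (out_word w q) = size w.
Proof. by elim: w q => [|y w IHw] q //=; rewrite IHw. Qed.

(* The Cantor space of one-sided infinite words, with the product of the
   discrete topologies. *)
Definition cantor_words (n : nat) : topologicalType :=
  prod_topology (fun _ : nat => discrete_topology 'I_n).

(* The map A_q: the i-th output letter is produced from the state reached
   after reading x_0 ... x_(i-1). *)
Definition state_map n (A : transducer n) (q : state A)
  (x : cantor_words n) : cantor_words n :=
  fun i => outp (x i : 'I_n) (trans_word (mkseq x i) q).

Definition homeomorphism (S T : topologicalType) (f : S -> T) : Prop :=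
  continuous f /\
  exists g : T -> S, [/\ continuous g, cancel f g & cancel g f].

Definition homeomorphism_state n (A : transducer n) (q : state A) : Prop :=
  homeomorphism (state_map q).

Definition omega_equivalent n (A : transducer n) (p q : state A) : Prop :=
  state_map p = state_map q.

Definition minimal_transducer n (A : transducer n) : Prop :=
  forall p q : state A, p <> q -> ~ omega_equivalent p q.

Definition product n (A B : transducer n) : transducer n :=
  @Transducer n (state A * state B)%type
    (fun x s => (trans x s.1, trans (outp x s.1) s.2))
    (fun x s => outp (outp x s.1) s.2).

Fixpoint pow_trans n (A : transducer n) (x : 'I_n) (s : seq (state A)) :
  seq (state A) :=
  if s is q :: s' then trans x q :: pow_trans (outp x q) s' else [::].

Fixpoint pow_outp n (A : transducer n) (x : 'I_n) (s : seq (state A)) : 'I_n :=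
  if s is q :: s' then pow_outp (outp x q) s' else x.

Lemma pow_trans_size n (A : transducer n) i x (s : i.-tuple (state A)) :
  size (pow_trans x s) == i.
Proof.
case: s => s /= /eqP <-.
by elim: s x => [|q s IHs] x //=; rewrite eqSS.
Qed.

(* The power A^i, with states the i-tuples of states of A; A^0 is the
   one-state identity transducer, and the next lemma identifies A^(i+1) with
   the product A * A^i. *)
Definition power n (A : transducer n) (i : nat) : transducer n :=
  @Transducer n (i.-tuple (state A))
    (fun x s => Tuple (pow_trans_size x s))
    (fun x s => pow_outp x s).

Lemma powerS n (A : transducer n) (i : nat) (x : 'I_n)
    (s : state (product A (power A i))) :
  let c (u : state (product A (power A i))) : state (power A i.+1) :=
    cons_tuple u.1 u.2 in
  trans x (c s) = c (trans x s) /\ outp x (c s) = outp x s.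
Proof. by split=> //; apply: val_inj. Qed.

(* [sync_map A k s]: the transducer A is synchronizing at level k, and s maps
   a word of length k to the state it forces. *)
Definition sync_map n (A : transducer n) (k : nat)
  (s : k.-tuple 'I_n -> state A) : Prop :=
  forall (w : k.-tuple 'I_n) (q : state A), trans_word w q = s w.

Definition synchronizing_at n (A : transducer n) (k : nat) : Prop :=
  exists s : k.-tuple 'I_n -> state A, sync_map s.

Definition min_sync_level n (A : transducer n) (m : nat) : Prop :=
  synchronizing_at A m /\ forall k, synchronizing_at A k -> m <= k.

(* The core is the image of s; it does not depend on the level at which it is
   computed. *)
Definition synchronizing_core n (A : transducer n) : Prop :=
  exists (k : nat) (s : k.-tuple 'I_n -> state A),
    sync_map s /\ forall q, exists w, s w = q.

Definition in_Ptilde n (A : transducer n) : Prop :=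
  minimal_transducer A /\ synchronizing_core A.

Definition in_Htilde n (A : transducer n) : Prop :=
  in_Ptilde A /\ exists q : state A, homeomorphism_state q.

(* The map f_A; s is applied to the word x_(i-k) ... x_(i-1). *)
Definition shift_map n (A : transducer n) (k : nat)
  (s : k.-tuple 'I_n -> state A) (x : int -> 'I_n) : int -> 'I_n :=
  fun i => outp (x i) (s [tuple x (i - k%:Z + (j : nat)%:Z)%R | j < k]).

(* [w] is in W_t. The bound on the length is not implied by the second
   condition: it excludes the shorter words that happen to force t. *)
Definition forces n (A : transducer n) (w : seq 'I_n) (t : state A) : Prop :=
  (exists2 m, min_sync_level A m & m <= size w) /\
  forall q, trans_word w q = t.

(* The word Gamma_i when p = (p_1, ..., p_l), and Lambda_i for the q_i. *)
Definition iter_out n (A : transducer n) (w : seq 'I_n) (p : seq (state A))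
  (i : nat) : seq 'I_n :=
  foldl (fun v q => out_word v q) w (take i p).

(* [is_split q p w b]: the triple (q, p, w) is a split of length m.+1 with
   bottom b; the state s_(i+1) is [tnth s i]. *)
Definition is_split n (A : transducer n) (r m : nat)
  (q p : m.+1.-tuple (state A)) (w : r.-tuple 'I_n) (b : {set state A}) :
  Prop :=
  exists (s : m.+1.-tuple (state A)) (t1 t2 : state A),
  [/\ t1 <> t2,
      b = [set t1; t2]%SET,
      forall i : 'I_m.+1, forces (iter_out w p i) (tnth s i) /\
                          forces (iter_out w q i) (tnth s i),
      forces (iter_out w p m.+1) t1 &
      forces (iter_out w q m.+1) t2].

Definition split_top n (A : transducer n) (m : nat)
  (q p : m.+1.-tuple (state A)) : {set state A} := [set thead p; thead q]%SET.

Definition bottom_depends_only_on_top n (A : transducer n) (r m : nat)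
  (q p : m.+1.-tuple (state A)) (w : r.-tuple 'I_n) (b : {set state A}) :
  Prop :=
  forall U1 U2 : m.-tuple (state A),
  is_split (cons_tuple (thead q) U1) (cons_tuple (thead p) U2) w b /\
  forall u u' : state A,
    @trans_word n (power A m.+2) w (rcons_tuple p u) =
    @trans_word n (power A m.+2) w (rcons_tuple (cons_tuple (thead p) U2) u') /\
    @trans_word n (power A m.+2) w (rcons_tuple q u) =
    @trans_word n (power A m.+2) w (rcons_tuple (cons_tuple (thead q) U1) u').

Definition bad_split n (A : transducer n) (r : nat) (a b : {set state A}) :
  Prop :=
  exists (m : nat) (q p : m.+1.-tuple (state A)) (w : r.-tuple 'I_n),
  [/\ is_split q p w b, bottom_depends_only_on_top q p w b &
      split_top q p = a].

(* The vertices of G_r(A) are the pairs satisfying [bad_pair]. *)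
Definition bad_pair n (A : transducer n) (r : nat) (a : {set state A}) :
  Prop := exists b, bad_split r a b.

Definition bad_edge n (A : transducer n) (r : nat) : rel {set state A} :=
  fun a b => `[< [/\ bad_pair r a, bad_pair r b & bad_split r a b] >].

Definition has_circuit n (A : transducer n) (r : nat) : Prop :=
  exists2 c : seq {set state A}, c != [::] & cycle (@bad_edge n A r) c.

Definition rational_word n (x : int -> 'I_n) : Prop :=
  (exists (N : int) (d : nat), 0 < d /\
     forall i : int, (N <= i)%R -> x (i + d%:Z)%R = x i) /\
  (exists (N : int) (d : nat), 0 < d /\
     forall i : int, (i <= N)%R -> x (i - d%:Z)%R = x i).

(* Main.v *)
(** Cut the right half of a bi-infinite word into blocks of length r, and look
at the column of states through which the successive iterates of f_A pass at the
start of each block.  Orient the bad pairs of a closed walk as (a_i, b_i), let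
G_i and L_i be the word and the states s_1, ..., s_l of the split leading from
(a_i, b_i) to (a_(i+1), b_(i+1)), and put T_i = |L_0| + ... + |L_(i-1)|.  The
states of A permute the letters, so the i-th block at time 0 can be chosen such
that at time T_i it has become G_i.  Two words with this common right half, whose
left halves force a_0 and b_0, have at block i columns that agree before time T_i
and then contain a_i and b_i respectively; if both orbits were eventually
periodic in time, this would be impossible for large i.

The common right half is eventually periodic: going back in time from the
"staircase" of the words G_i, the picture is invariant under one turn of the
closed walk, and the words at distance u behind the staircase are produced by
iterating a map on a finite set u times. *)

Require Import Defs.
From mathcomp Require Import all_boot all_algebra.
From mathcomp Require Import boolp classical_sets functions cardinality topology.
From mathcomp Require Import zify.

Set Implicit Arguments.
Unset Strict Implicit.
Unset Printing Implicit Defensive.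

Import GRing.Theory Num.Theory.

(** * Eventually periodic orbits *)

Lemma finite_orbit_eventually_periodic (T : Type) (f : T -> T) (x : T) :
  finite_set (range (fun t => iter t f x)) ->
  exists P p, 0 < p /\ forall t, P <= t -> iter (t + p) f x = iter t f x.
Proof.
move=> fin.
have [i [j [lt_ij eq_ij]]] :
    exists i j, i < j /\ iter i f x = iter j f x.
  apply: contrapT => noteq; apply: infinite_nat.
  have inj : {in setT &, injective (fun t => iter t f x)}.
    move=> i j _ _ eq_ij; apply: contrapT => /eqP; rewrite neq_ltn.
    by case/orP=> lt_ij; case: noteq; [exists i, j | exists j, i].
  by rewrite -(eq_finite_set (inj_card_eq inj)).
exists i, (j - i); rewrite subn_gt0; split=> // t le_it.
by rewrite -(subnK le_it) -addnA subnKC ?(ltnW lt_ij)// !iterD eq_ij.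
Qed.

Lemma finType_eventually_periodic (T : finType) (f : T -> T) (x : T) :
  exists P p, 0 < p /\ forall t, P <= t -> iter (t + p) f x = iter t f x.
Proof. exact/finite_orbit_eventually_periodic/finite_finset. Qed.

(** * Words read by a state, and injectivity of the output functions *)

Section Words.
Variables (n : nat) (A : transducer n).
Implicit Types (q : state A) (w : seq 'I_n) (u : seq (state A)).

Lemma trans_word_cat w1 w2 q :
  trans_word (w1 ++ w2) q = trans_word w2 (trans_word w1 q).
Proof. exact: foldl_cat. Qed.

Lemma out_word_mkseq (y : cantor_words n) q N :
  out_word (mkseq y N) q = mkseq (state_map q y) N.
Proof.
elim: N => [|N IHN] //.
have mkseqS (z : nat -> 'I_n) : mkseq z N.+1 = rcons (mkseq z N) (z N).
  by rewrite /mkseq -{1}addn1 iotaD map_cat cats1.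
by rewrite !mkseqS out_word_rcons IHN.
Qed.

Definition out_tuple r q (w : r.-tuple 'I_n) : r.-tuple 'I_n :=
  tcast (etrans (size_out_word w q) (size_tuple w)) (in_tuple (out_word w q)).

Lemma out_tupleE r q (w : r.-tuple 'I_n) :
  out_tuple q w = out_word w q :> seq _.
Proof. by rewrite val_tcast. Qed.

(* Surjectivity of the map of a state on infinite words passes to words of
   each finite length, where it is equivalent to injectivity. *)
Lemma homeomorphism_state_out_word_inj q N :
  homeomorphism_state q ->
  forall w1 w2, size w1 = N -> size w2 = N ->
  out_word w1 q = out_word w2 q -> w1 = w2.
Proof.
case=> _ [g [_ _ gK]] w1 w2 sz1 sz2 eq12.
case: N sz1 sz2 => [/size0nil-> /size0nil-> //|N] sz1 sz2.
have d : 'I_n by case: (w1) sz1.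
pose g' (w : N.+1.-tuple 'I_n) : N.+1.-tuple 'I_n :=
  Tuple (introT eqP (size_mkseq (g (fun i => nth d w i)) N.+1)).
have g'K : cancel g' (@out_tuple N.+1 q).
  move=> w; apply: val_inj; rewrite /= out_tupleE [LHS]out_word_mkseq gK.
  by rewrite -[RHS](mkseq_nth d) size_tuple.
move/eqP: sz1 => sz1; move/eqP: sz2 => sz2.
suff : Tuple sz1 = Tuple sz2 by move/(congr1 val).
by apply: (can_inj (canF_sym g'K)); apply: val_inj; rewrite /= !out_tupleE.
Qed.

(** A word forcing [q] leads from the homeomorphism state to [q]; two letters with equal output at
    [q] would extend it to two words with equal output at the homeomorphism state. *)
Lemma in_Htilde_outp_inj q : in_Htilde A -> injective (fun x : 'I_n => outp x q).
Proof.
case=> [[_ [k [s [s_sync s_onto]]]] [q0 q0_homeo]] x y eq_xy.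
have [w wq] := s_onto q.
have wq0 : trans_word w q0 = q by rewrite s_sync.
suff : rcons w x = rcons w y by case/rcons_inj.
apply: (homeomorphism_state_out_word_inj q0_homeo (N := k.+1));
  rewrite ?size_rcons ?size_tuple //.
by rewrite !out_word_rcons wq0 eq_xy.
Qed.

Lemma out_tuple_inj r q :
  (forall q', injective (fun x : 'I_n => outp x q')) ->
  injective (@out_tuple r q).
Proof.
move=> inj w1 w2 /(congr1 val) /=; rewrite !out_tupleE => eq12.
apply: val_inj => /=.
have : size w1 = size w2 by rewrite !size_tuple.
elim: {w1 w2}(tval w1) (tval w2) q eq12 => [|x w1 IHw] [|y w2] //= q.
by case=> /inj-> eq12 [] /(IHw _ _ eq12)->.
Qed.

(* The action of a word on the states of the powers of [A], freed from the
   tuple bookkeeping. *)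
Fixpoint pow_word w u : seq (state A) :=
  if u is q :: u' then trans_word w q :: pow_word (out_word w q) u' else [::].

Lemma size_pow_word w u : size (pow_word w u) = size u.
Proof. by elim: u w => [|q u IHu] w //=; rewrite IHu. Qed.

Lemma trans_word_power m w (u : m.-tuple (state A)) :
  @trans_word n (power A m) w u = pow_word w u :> seq _.
Proof.
elim: w u => [|x w IHw] u /=.
  by elim: {u}(tval u) => [|q u /= <-].
rewrite IHw /=; elim: {u}(tval u) x w {IHw} => [|q u IHu] x w //=.
by rewrite IHu.
Qed.

Lemma nth_pow_word q0 w u i : i < size u ->
  nth q0 (pow_word w u) i = trans_word (iter_out w u i) (nth q0 u i).
Proof.
elim: u w i => [|q u IHu] w [|i] //= lt_i.
by rewrite IHu.
Qed.

Lemma synchronizing_trans_word k (s : k.-tuple 'I_n -> state A) :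
  sync_map s -> forall w q q', k <= size w -> trans_word w q = trans_word w q'.
Proof.
move=> s_sync w q q' le_k.
have sz : size (drop (size w - k) w) == k by rewrite size_drop subKn.
rewrite -(cat_take_drop (size w - k) w) !trans_word_cat.
by rewrite !(s_sync (Tuple sz)).
Qed.

End Words.

(** * The action of f_A on finite blocks *)

Section ShiftMap.
Variables (n : nat) (A : transducer n) (k : nat) (s : k.-tuple 'I_n -> state A).
Hypothesis s_sync : sync_map s.
Implicit Types (y : int -> 'I_n) (m : int).
Local Open Scope ring_scope.

Definition forced_state y m : state A :=
  s [tuple y (m - k%:Z + (j : nat)%:Z)%R | j < k].

Definition block y m l : seq 'I_n := mkseq (fun i : nat => y (m + i%:Z)%R) l.

Lemma block_cons y m l : block y m l.+1 = y m :: block y (m + 1) l.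
Proof.
rewrite /block /mkseq /= addr0; congr cons.
rewrite (iotaDl 1 0) -map_comp; apply: eq_map => i /=.
by rewrite PoszD addrA.
Qed.

Lemma block_rcons y m l : block y m l.+1 = rcons (block y m l) (y (m + l%:Z)).
Proof. by rewrite /block /mkseq -{1}addn1 iotaD map_cat cats1. Qed.

Lemma forced_stateE y m q :
  forced_state y m = trans_word (block y (m - k%:Z) k) q.
Proof.
rewrite /forced_state -(s_sync _ q); congr trans_word.
rewrite /block /mkseq -val_enum_ord -map_comp.
by apply: (@eq_from_nth _ (y 0)) => [|i]; rewrite ?size_map.
Qed.

Lemma forced_state1 y m : forced_state y (m + 1) = trans (y m) (forced_state y m).
Proof.
pose q := forced_state y m.
(* The starting state in [forced_stateE] is free: with this choice both sides read the same k + 1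
   letters from [q]. *)
rewrite (forced_stateE y m q) (forced_stateE y _ (trans (y (m - k%:Z)) q)).
have -> : m + 1 - k%:Z = m - k%:Z + 1 by rewrite addrAC.
rewrite -[LHS]/(trans_word (y (m - k%:Z) :: block y (m - k%:Z + 1) k) q).
by rewrite -block_cons block_rcons subrK trans_word_rcons.
Qed.

Lemma forced_state_block y m l :
  forced_state y (m + l%:Z) = trans_word (block y m l) (forced_state y m).
Proof.
elim: l m => [|l IHl] m; first by rewrite addr0.
by rewrite block_cons /= -forced_state1 -IHl intS addrA.
Qed.

Lemma block_shift_map y m l :
  block (shift_map s y) m l = out_word (block y m l) (forced_state y m).
Proof.
elim: l m => [|l IHl] m //.
by rewrite !block_cons /= IHl forced_state1.
Qed.

End ShiftMap.

(** * Splits as transformations of columns of states *)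

Section Splits.
Variables (n : nat) (A : transducer n) (r : nat).
Implicit Types (w : r.-tuple 'I_n) (v : state A * state A).

(** One half of a split whose bottom depends only on the top: crossing the block [w], the column
    keeps no trace of the states after [a]. *)
Definition forces_column w (a : state A) (L : seq (state A)) (b : state A) :=
  forall U, size U = size L -> pow_word w (a :: U) = rcons L b.

(** Component i of the power reads [iter_out w p i], which forces its new state; the extra component
    [u] reads the last output, which forces [t]. *)
Lemma forces_pow_word m w (p : m.+1.-tuple (state A)) (L : m.+1.-tuple (state A))
    (t : state A) :
  (forall i : 'I_m.+1, forces (iter_out w p i) (tnth L i)) ->
  forces (iter_out w p m.+1) t ->
  forall u, pow_word w (rcons p u) = rcons L t.
Proof.
move=> L_forced t_forced u.
apply: (@eq_from_nth _ t); first by rewrite size_pow_word !size_rcons !size_tuple.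
move=> i; rewrite size_pow_word => lt_i; rewrite nth_pow_word //.
have le_i : i <= m.+1 by rewrite size_rcons size_tuple ltnS in lt_i.
have -> : iter_out w (rcons p u) i = iter_out w p i.
  rewrite /iter_out -cats1 take_cat size_tuple.
  case: ltngtP le_i => // -> _.
  by rewrite subnn cats0 take_oversize ?size_tuple.
rewrite [RHS]nth_rcons size_tuple; case: ltngtP le_i => // [lt_im|->] _.
  by case: (L_forced (Ordinal lt_im)) => _ ->; rewrite (tnth_nth t).
by case: t_forced => _ ->.
Qed.

Lemma bad_split_forces_column S S' v :
  bad_split r S S' -> v.1 <> v.2 -> [set v.1; v.2]%SET = S ->
  exists v' w L, [/\ v'.1 <> v'.2, [set v'.1; v'.2]%SET = S', 0 < size L,
    forces_column w v.1 L v'.1 & forces_column w v.2 L v'.2].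
Proof.
case: v => v1 v2 /= [m [q [p [w [[L [t1 [t2 [t12 defS' Lpq pt1 qt2]]]]]]]]].
move=> only_top <- v12; rewrite /split_top => eqS.
have col (x : m.+1.-tuple (state A)) t :
    (forall i : 'I_m.+1, forces (iter_out w x i) (tnth L i)) ->
    forces (iter_out w x m.+1) t ->
    (forall U u u', @trans_word n (power A m.+2) w (rcons_tuple x u) =
     @trans_word n (power A m.+2) w
        (rcons_tuple (cons_tuple (thead x) U) u')) ->
    forces_column w (thead x) L t.
  move=> xL xt only U; rewrite size_tuple.
  (* All but the last state of [U] are the free states of the split; the last one is the extra
     component, of index m + 1. *)
  case/lastP: U => // U u; rewrite size_rcons => /eqP; rewrite eqSS => szU.
  have /(congr1 val) := only (Tuple szU) u u; rewrite /= !trans_word_power /=.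
  by move <-; rewrite -(forces_pow_word xL xt u).
have pcol : forces_column w (thead p) L t1.
  apply: (col p t1) => // [i|U u u'].
    by case: (Lpq i).
  by have [_ /(_ u u')[]] := only_top U U.
have qcol : forces_column w (thead q) L t2.
  apply: (col q t2) => // [i|U u u'].
    by case: (Lpq i).
  by have [_ /(_ u u')[]] := only_top U U.
(* The pair [v] lists the top in one of two orders; t1 and t2 are ordered accordingly, so that each
   state can be followed along a walk. *)
have /set2P[] : v1 \in [set thead p; thead q]%SET by rewrite -eqS set21.
  move=> v1p; have /set2P[v2p|v2q] : v2 \in [set thead p; thead q]%SET.
  - by rewrite -eqS set22.
  - by case: v12; rewrite v1p.
  by exists (t1, t2), w, L; rewrite /= v1p v2q size_tuple.
move=> v1q; have /set2P[v2p|v2q] : v2 \in [set thead p; thead q]%SET.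
- by rewrite -eqS set22.
- exists (t2, t1), w, L; rewrite /= v1q v2p size_tuple finset.setUC.
  by split=> // /esym.
by case: v12; rewrite v1q.
Qed.

End Splits.

(** * The staircase and its evolution backwards in time *)

Section Staircase.
Variables (n : nat) (A : transducer n) (r : nat).
Hypothesis outp_inj : forall q : state A, injective (fun x : 'I_n => outp x q).
Hypothesis force_r :
  forall w (q q' : state A), size w = r -> trans_word w q = trans_word w q'.
Variables (I : finType) (nxt prv : I -> I) (e0 : I) (q0 : state A).
Hypothesis nxtK : cancel nxt prv.
Variables (w : I -> r.-tuple 'I_n) (L : I -> seq (state A)).
Hypothesis L_gt0 : forall e, 0 < size (L e).

(** Each state permutes the words of length r, so a block can be traced back in time. *)
Definition unread q : r.-tuple 'I_n -> r.-tuple 'I_n :=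
  invF (out_tuple_inj (r := r) (q := q) outp_inj).

Definition memory := \max_e size (L e).

(* The words lying a fixed number of steps behind the staircase, one for each
   edge, together with the most recently seen states of the next column; entry 0
   of this record is the last state seen.  At [initial_config] the record is
   filled with the states [L e], which lie ahead of the staircase. *)
Definition config : finType :=
  {ffun I -> r.-tuple 'I_n * {ffun 'I_memory.+1 -> state A}}.

Definition initial_config : config :=
  [ffun e => (w e, [ffun i : 'I_memory.+1 => nth q0 (L e) i])].

(** Block i at time T_i - u - 1 is read from the state of column i at that time, which equals
    T_(i-1) - u + l - 1 with l = |L_(i-1)|: entry l - 1 in the record of the previous edge. The new
    word forces the newest entry, whence the arbitrary [q0]; older entries move up by one. *)
Definition back (V : config) : config :=
  [ffun e =>
     let d := unread ((V (prv e)).2 (inord (size (L (prv e))).-1)) (V e).1 in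
     (d, [ffun i : 'I_memory.+1 =>
            if i == 0 :> nat then trans_word d q0 else (V e).2 (inord i.-1)])].

Definition word_at e u := (iter u back initial_config e).1.
Definition state_at e u i := (iter u back initial_config e).2 (inord i).

Lemma word_at0 e : word_at e 0 = w e.
Proof. by rewrite /word_at /= ffunE. Qed.

Lemma state_at0 e i : i < size (L e) -> state_at e 0 i = nth q0 (L e) i.
Proof.
move=> lt_i; rewrite /state_at /= !ffunE inordK //.
by rewrite ltnS (leq_trans (ltnW lt_i)) // (leq_bigmax (F := fun e => size (L e))).
Qed.

Lemma out_word_at e u :
  out_word (word_at e u.+1) (state_at (prv e) u (size (L (prv e))).-1)
    = word_at e u.
Proof. by rewrite /word_at /= ffunE /= -out_tupleE f_invF. Qed.

Lemma state_atS e u : state_at e u.+1 0 = trans_word (word_at e u.+1) q0.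
Proof. by rewrite /state_at /word_at /= !ffunE /= inordK. Qed.

(** Depth u + t is t steps earlier than depth u, so both sides denote the state of the column at one
    and the same time. *)
Lemma state_at_shift e u i t :
  i + t <= memory -> state_at e (u + t) (i + t) = state_at e u i.
Proof.
elim: t => [|t IHt]; first by rewrite !addn0.
rewrite !addnS => lt_it; rewrite -(IHt (ltnW lt_it)).
by rewrite {1}/state_at /= !ffunE inordK.
Qed.

Definition stair i := iter i nxt e0.
Definition height i := \sum_(j < i) size (L (stair j)).
(** [height i] is T_i, so this is block i at time 0. *)
Definition base_word i := word_at (stair i) (height i).

Lemma heightS i : height i.+1 = height i + size (L (stair i)).
Proof. by rewrite /height big_ord_recr. Qed.

Lemma leq_height i : i <= height i.
Proof.
elim: i => [|i IHi] //; rewrite heightS -addn1.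
by rewrite leq_add.
Qed.

(** Over one period p of [stair] the height grows by a constant D; over p' * p edges it grows by D *
    p', a multiple of the period p' of [back]. *)
Lemma base_word_eventually_periodic :
  exists J p, 0 < p /\ forall i, J <= i -> base_word (i + p) = base_word i.
Proof.
have [P [p [p_gt0 stairP]]] := finType_eventually_periodic nxt e0.
have [P' [p' [p'_gt0 backP]]] := finType_eventually_periodic back initial_config.
have [D heightD] : exists D, forall i, P <= i -> height (i + p) = height i + D.
  exists (height (P + p) - height P) => i /subnK <-; elim: (i - P) => [|j IHj].
    rewrite add0n subnKC //; elim: (p) => [|m]; first by rewrite addn0.
    by rewrite addnS heightS => /leq_trans->; rewrite ?leq_addr.
  rewrite !addSn !heightS IHj /stair stairP ?leq_addl //.
  by rewrite addnAC.
exists (maxn P P'), (p' * p); rewrite muln_gt0 p_gt0 p'_gt0; split=> // i.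
rewrite geq_max => /andP[le_P le_P']; rewrite /base_word /word_at.
have [-> ->] : stair (i + p' * p) = stair i /\
               height (i + p' * p) = height i + D * p'.
  elim: p' {p'_gt0 backP} => [|m [IHs IHh]]; first by rewrite mul0n muln0 !addn0.
  have le_Pm : P <= i + m * p by rewrite (leq_trans le_P) ?leq_addr.
  rewrite mulSn [p + _]addnC addnA heightD // IHh.
  split; first by rewrite /stair stairP.
  by rewrite mulnS -addnA [_ * m + _]addnC.
suff -> : iter (height i + D * p') back initial_config =
  iter (height i) back initial_config by [].
elim: D {heightD} => [|D IHD]; first by rewrite addn0.
rewrite mulSn [p' + _]addnC addnA backP //.
by rewrite (leq_trans _ (leq_addr _ _)) // (leq_trans le_P') // leq_height.
Qed.

(** [Y i t] is block i at time t and [C i t] the state at its start; a stretch of column i is then a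
    state of a power, and reading the block moves it to column i + 1. *)
Lemma pow_word_column (Y : nat -> nat -> seq 'I_n) (C : nat -> nat -> state A) :
  (forall i t, Y i t.+1 = out_word (Y i t) (C i t)) ->
  (forall i t, C i.+1 t = trans_word (Y i t) (C i t)) ->
  forall i t m, pow_word (Y i t) (mkseq (fun j => C i (t + j)) m)
    = mkseq (fun j => C i.+1 (t + j)) m.
Proof.
move=> YS CS i t m; elim: m t => [|m IHm] t //.
rewrite /mkseq /= !addn0 CS -YS; congr cons.
rewrite (iotaDl 1 0) -!map_comp.
under eq_map => j do rewrite /= addnA addn1.
under [RHS]eq_map => j do rewrite /= addnA addn1.
exact: IHm.
Qed.

(** Induction on i: the states prescribed before T_i make block i become [w] exactly when its column
    shows [a], and the forced column then prescribes the next states. The values before T_i do not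
    involve [a], so two words sharing their right half agree there. *)
Lemma staircase_column (Y : nat -> nat -> seq 'I_n) (C : nat -> nat -> state A)
    (a : I -> state A) :
  (forall i, Y i 0 = base_word i) ->
  (forall i t, Y i t.+1 = out_word (Y i t) (C i t)) ->
  (forall i t, C i.+1 t = trans_word (Y i t) (C i t)) ->
  C 0 0 = a e0 ->
  (forall e, forces_column (w e) (a e) (L e) (a (nxt e))) ->
  forall i, (forall t, t < height i ->
      C i t = state_at (prv (stair i)) (height i - t.+1)
                       (size (L (prv (stair i)))).-1) /\
    C i (height i) = a (stair i).
Proof.
move=> Y0 YS CS C00 step; elim=> [|i [IHbelow IHtop]].
  by rewrite /height big_ord0.
have YE t : t <= height i -> Y i t = word_at (stair i) (height i - t).
  elim: t => [_|t IHt lt_t]; first by rewrite Y0 subn0.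
  rewrite YS IHt ?(ltnW lt_t) // IHbelow // -[in LHS](subnSK lt_t).
  exact: out_word_at.
have prvS : prv (stair i.+1) = stair i by exact: nxtK.
set l := size (L (stair i)).
have l_gt0 : 0 < l by exact: L_gt0.
have le_l : l <= memory by exact: (leq_bigmax (F := fun e => size (L e))).
have col := pow_word_column YS CS i (height i) l.+1.
have Ytop : Y i (height i) = w (stair i) by rewrite YE // subnn word_at0.
have {col} col : mkseq (fun j => C i.+1 (height i + j)) l.+1
    = rcons (L (stair i)) (a (stair i.+1)).
  rewrite -col Ytop /mkseq /= addn0 IHtop; apply: step.
  by rewrite size_map size_iota.
have colE j : j <= l ->
    C i.+1 (height i + j) = nth q0 (rcons (L (stair i)) (a (stair i.+1))) j.
  by move=> le_j; rewrite -col nth_mkseq.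
rewrite prvS heightS -/l; split; last by rewrite colE // nth_rcons ltnn eqxx.
move=> t lt_t; case: (ltnP t (height i)) => [lt_ti|le_it].
  (* Before T_i, block i forces the state: it is entry 0 at depth T_i - t, hence entry l - 1 at a
     depth l - 1 greater. *)
  rewrite CS (force_r _ q0) ?YE ?size_tuple ?(ltnW lt_ti) //.
  have -> : height i + l - t.+1 = (height i - t) + l.-1 by lia.
  rewrite -{2}[l.-1]add0n state_at_shift; last first.
    by rewrite (leq_trans (leq_pred _)).
  by rewrite -(subnSK lt_ti) state_atS.
(* From T_i on, the state is the entry of index t - T_i of [L], stored in the initial record. *)
rewrite -(subnKC le_it) in lt_t *.
move: (t - height i) lt_t => j; rewrite ltn_add2l => lt_j.
rewrite colE ?(ltnW lt_j) // nth_rcons lt_j -addnS subnDl -state_at0 //.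
have jl : j + (l - j.+1) = l.-1 by lia.
rewrite -(state_at_shift (stair i) 0 (i := j) (t := l - j.+1)) jl ?add0n //.
by rewrite (leq_trans (leq_pred _)).
Qed.

End Staircase.

(** * Bi-infinite words with prescribed right half *)

Section Glue.
Variables (n r : nat) (d : 'I_n) (u : seq 'I_n) (Z : nat -> r.-tuple 'I_n).

(** [Negz m] is the position -(m + 1), hence the reversal: [u] ends just before position 0, and the
    default [d] fills everything further left. *)
Definition glue (i : int) : 'I_n :=
  match i with
  | Posz m => nth d (Z (m %/ r)) (m %% r)
  | Negz m => nth d (rev u) m
  end.

Lemma block_glue_right j : block glue (Posz (j * r)) r = Z j.
Proof.
apply: (@eq_from_nth _ d); first by rewrite size_mkseq size_tuple.
move=> i; rewrite size_mkseq => lt_i; rewrite nth_mkseq // -PoszD /=.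
have r_gt0 : 0 < r by exact: leq_ltn_trans lt_i.
by rewrite divnMDl // divn_small // addn0 modnMDl modn_small.
Qed.

Lemma block_glue_left : block glue (0 - (size u)%:Z)%R (size u) = u.
Proof.
apply: (@eq_from_nth _ d); first by rewrite size_mkseq.
move=> i; rewrite size_mkseq => lt_i; rewrite nth_mkseq //.
have -> : (0 - (size u)%:Z + i%:Z)%R = Negz (size u - i.+1).
  by rewrite NegzE; lia.
rewrite /glue nth_rev; last lia.
by congr nth; lia.
Qed.

Lemma rational_glue :
  (exists J p, 0 < p /\ forall i, J <= i -> Z (i + p) = Z i) ->
  0 < r -> rational_word glue.
Proof.
move=> [J [p [p_gt0 Zp]]] r_gt0; split.
  exists (Posz (J * r)), (p * r); rewrite muln_gt0 p_gt0; split=> // -[m|//] le_m.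
  rewrite -PoszD /glue addnC divnMDl // modnMDl addnC Zp //.
  by rewrite leq_divRL.
(* Left of [u] the word is constant. *)
exists (- (size u).+1%:Z)%R, 1; split=> // -[m|m]; first lia.
rewrite NegzE => le_m.
have -> : (- m.+1%:Z - 1)%R = Negz m.+1 by rewrite NegzE; lia.
rewrite -NegzE /glue !nth_default ?size_rev //; lia.
Qed.

End Glue.

(** * The closed walk of oriented bad pairs, and the infinite orbit *)

Lemma bad_pairs_periodic_walk n (A : transducer n) r :
  0 < n -> has_circuit A r ->
  exists p (v : 'I_p.+1 -> state A * state A) (w : 'I_p.+1 -> r.-tuple 'I_n)
    (L : 'I_p.+1 -> seq (state A)),
  forall e, [/\ (v e).1 <> (v e).2, 0 < size (L e),
    forces_column (w e) (v e).1 (L e) (v (ordS e)).1 &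
    forces_column (w e) (v e).2 (L e) (v (ordS e)).2].
Proof.
move=> n_gt0 [c c_neq0 c_cycle].
(* Successors are chosen on ordered pairs: one turn of the circuit may swap the two states of a bad
   pair. *)
pose good (v : state A * state A) := v.1 <> v.2 /\ [set v.1; v.2]%SET \in c.
have /choice[g gP] (v : state A * state A) :
    exists d : (state A * state A) * (r.-tuple 'I_n * seq (state A)),
    good v -> [/\ good d.1, 0 < size d.2.2,
      forces_column d.2.1 v.1 d.2.2 d.1.1 & forces_column d.2.1 v.2 d.2.2 d.1.2].
  have [[v12 v_c]|not_good] := pselect (good v); last first.
    by exists (v, (nseq_tuple r (Ordinal n_gt0), [::])).
  have /asboolP[_ _ split_v] := next_cycle c_cycle v_c.
  have [v' [w [L [v12' v'S L_gt0 col1 col2]]]] :=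
    bad_split_forces_column split_v v12 erefl.
  by exists (v', (w, L)) => _; split=> //; split; rewrite ?v'S ?mem_next.
(* A vertex of the circuit is the bottom of a split, so it consists of two distinct states. *)
have [v0 v0_good] : exists v, good v.
  case: c c_neq0 c_cycle @good gP => // S c _ c_cycle good gP.
  have Sc : S \in S :: c by rewrite mem_head.
  have /asboolP[_ _] := prev_cycle c_cycle Sc.
  move=> [m [q [p [w [[L [t1 [t2 [t12 SE _ _ _]]]] _ _]]]]].
  by exists (t1, t2); split=> //=; rewrite -SE.
pose step v := (g v).1.
have walk_good t : good (iter t step v0).
  by elim: t => [|t /gP[]].
(* There are finitely many ordered pairs, so the walk closes up with its orientations after the
   first P steps. *)
have [P [[|p] [// _ stepP]]] := finType_eventually_periodic step v0.
pose v (e : 'I_p.+1) := iter (P + e) step v0.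
have vS e : v (ordS e) = step (v e).
  rewrite /v /= -iterS -addnS; have := ltn_ord e; rewrite leq_eqVlt.
  case/orP=> [/eqP[->]|lt_e]; last by rewrite modn_small.
  by rewrite modnn addn0 stepP.
exists p, v, (fun e => (g (v e)).2.1), (fun e => (g (v e)).2.2) => e.
have v_good : good (v e) by exact: walk_good.
by have [_ L_gt0 col1 col2] := gP _ v_good; rewrite vS; split=> //; case: v_good.
Qed.

Theorem theorem1p1 (n : nat) (n_ge2 : (2 <= n)%N)
  (A : transducer n) (A_in_H : in_Htilde A)
  (k : nat) (s : k.-tuple 'I_n -> state A) (A_sync : sync_map s)
  (r : nat) (k_le_r : (k <= r)%N)
  (circuit : has_circuit A r) :
  exists x : int -> 'I_n,
    rational_word x /\
    infinite_set (range (fun t : nat => iter t (shift_map s) x)).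
Proof.
have n_gt0 : 0 < n by exact: ltnW.
have [p [v [w [L walk]]]] := bad_pairs_periodic_walk n_gt0 circuit.
have outp_inj q := in_Htilde_outp_inj (q := q) A_in_H.
have force_r u (q q' : state A) : size u = r -> trans_word u q = trans_word u q'.
  by move=> szu; apply: (synchronizing_trans_word A_sync); rewrite szu.
have r_gt0 : 0 < r.
  (* For r = 0 the empty word would force a state, and the two states of a bad pair would
     coincide. *)
  rewrite lt0n; apply/eqP => r0; have [v12 _ _ _] := walk ord0; case: v12.
  exact: (force_r [::]).
have L_gt0 e : 0 < size (L e) by case: (walk e).
pose q0 := (v ord0).1.
pose Z := base_word outp_inj (@ordS p.+1) (@ord_pred p.+1) ord0 q0 w L.
have Z_per := base_word_eventually_periodic outp_inj
  (@ordS p.+1) (@ord_pred p.+1) ord0 q0 w L_gt0.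
have forcing (q : state A) : exists u, forall q', trans_word u q' = q.
  case: A_in_H => [[_ [k' [s' [s'_sync s'_onto]]]] _].
  by have [u <-] := s'_onto q; exists u => q'; exact: s'_sync.
pose orbit x t := iter t (shift_map s) x.
pose T i := height (@ordS p.+1) ord0 L i.
pose idx i := stair (@ordS p.+1) ord0 i.
have column (a : 'I_p.+1 -> state A) u :
    (forall q', trans_word u q' = a ord0) ->
    (forall e, forces_column (w e) (a e) (L e) (a (ordS e))) ->
  forall i,
    let x := glue (Ordinal n_gt0) u Z in
    let C t := forced_state s (orbit x t) (Posz (i * r)) in
    (forall t, t < T i -> C t =
       state_at outp_inj (@ord_pred p.+1) q0 w L (ord_pred (idx i)) (T i - t.+1)
         (size (L (ord_pred (idx i)))).-1)
    /\ C (T i) = a (idx i).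
  move=> u_forces a_col; move=> i x; move: i.
  pose Y i t := block (orbit x t) (Posz (i * r)) r.
  apply: (@staircase_column n A r outp_inj force_r _ _ _ ord0 q0 (@ordSK p.+1) w L
    L_gt0 Y (fun i t => forced_state s (orbit x t) (Posz (i * r))) a) => //.
  - by move=> i; exact: block_glue_right.
  - by move=> i t; exact: (block_shift_map A_sync).
  - by move=> i t; rewrite -(forced_state_block A_sync) -PoszD mulSnr.
  (* Position 0 is the right end of [u], which forces the first state of column 0. *)
  have -> : Posz (0 * r) = (0 - (size u)%:Z + (size u)%:Z)%R by rewrite subrK.
  rewrite (forced_state_block A_sync).
  by rewrite block_glue_left u_forces.
have [u1 u1_forces] := forcing (v ord0).1.
have [u2 u2_forces] := forcing (v ord0).2.
have {}column1 := column (fun e => (v e).1) u1 u1_forces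
  ltac:(by move=> e; case: (walk e)).
have {column} column2 := column (fun e => (v e).2) u2 u2_forces
  ltac:(by move=> e; case: (walk e)).
set x1 := glue _ u1 Z in column1; set x2 := glue _ u2 Z in column2.
have [x1_inf|x1_fin] := pselect (infinite_set (range (orbit x1))).
  by exists x1; split=> //; exact: rational_glue.
have [x2_inf|x2_fin] := pselect (infinite_set (range (orbit x2))).
  by exists x2; split=> //; exact: rational_glue.
have [P1 [p1 [p1_gt0 per1]]] :=
  finite_orbit_eventually_periodic (contrapT x1_fin).
have [P2 [p2 [p2_gt0 per2]]] :=
  finite_orbit_eventually_periodic (contrapT x2_fin).
have perM (x : int -> 'I_n) P m :
    (forall t, P <= t -> orbit x (t + m) = orbit x t) ->
    forall j t, P <= t -> orbit x (t + j * m) = orbit x t.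
  move=> per; elim=> [|j IHj] t le_t; first by rewrite addn0.
  by rewrite mulSn addnCA addnC per ?IHj // (leq_trans le_t) ?leq_addr.
(* Since T_i >= i, going back from T_i by the common period p1 * p2 stays beyond both preperiods. *)
pose i := P1 + P2 + p1 * p2.
have le_iT : i <= T i by exact: leq_height.
have [below1 top1] := column1 i; have [below2 top2] := column2 i.
pose t := T i - p1 * p2.
have lt_t : t < T i by rewrite /t; nia.
have tT : T i = t + p1 * p2 by rewrite /t; nia.
(* Periodicity moves the two distinct states at T_i to the earlier time t, where the columns
   agree. *)
have [v12 _ _ _] := walk (idx i); case: v12.
rewrite -top1 -top2 tT (perM x2 P2 p2 per2); last by rewrite /t; lia.
rewrite mulnC (perM x1 P1 p1 per1); last by rewrite /t; lia.
by rewrite below1 // below2.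
Qed.
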